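(* There exist path-complete graphs $\mathcal{G},\widetilde{\mathcal{G}}$ on $\Sigma=\{1,2\}$, both strongly connected and both such that removing any edge destroys path-completeness, with the following two properties: (a) for every class $\mathcal{F}=\bigcup_{n\in\mathbb{N}_{>0}}\mathcal{F}_n$ of dynamics consisting of invertible linear maps, and every template $\mathcal{V}$ closed under forward composition with $\mathcal{F}$, one has $\mathcal{G}\leq_{\mathcal{V},\mathcal{F}}\widetilde{\mathcal{G}}$; and (b) the forward composition lift $\mathcal{G}^{\circ}$ does not simulate $\widetilde{\mathcal{G}}$.
   Context: A labeled digraph $\mathcal{G}=(S,E)$ on a finite alphabet $\Sigma$ has a finite set of nodes $S$ and a set of labeled edges $E\subseteq S\times S\times\Sigma$. It is path-complete if for every finite word $i_1i_2\cdots i_k\in\Sigma^k$ there are nodes $s_1,\dots,s_{k+1}\in S$ with $(s_j,s_{j+1},i_j)\in E$ for all $j\in\{1,\dots,k\}$. Forward composition lift: for $T\in\mathbb{N}_{>0}$, $\mathcal{G}^{\circ T}=(S^{\circ T},E^{\circ T})$ has nodes $S^{\circ T}=\{(s,j_1,\dots,j_T)\,|\,s\in S,\ (j_1,\dots,j_T)\in\Sigma^T\}$ and edges $$E^{\circ T}=\{((a,j_1,\dots,j_T),(b,i,j_1,\dots,j_{T-1}),j_T)\,|\,(a,b,i)\in E,\ (j_1,\dots,j_T)\in\Sigma^T\}.$$ Set $\mathcal{G}^{\circ 0}=\mathcal{G}$; then $\mathcal{G}^{\circ}=\bigcup_{T\in\mathbb{N}_{\geq 0}}\mathcal{G}^{\circ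 T}$ (union of node sets and of edge sets). A (possibly infinite) labeled digraph $(S_1,E_1)$ simulates $(S_2,E_2)$ if there is a map $R:S_2\to S_1$ such that $(a,b,i)\in E_2$ implies $(R(a),R(b),i)\in E_1$. $\mathrm{Lyap}_0(\mathbb{R}^n)$ is the set of $V\in C^0(\mathbb{R}^n;\mathbb{R}_{\geq 0})$ with $V(0)=0$, $V(x)>0$ for $x\neq 0$, and $\alpha_1(\|x\|_2)\leq V(x)\leq\alpha_2(\|x\|_2)$ for all $x$, for some class-$\mathcal{K}_\infty$ functions $\alpha_1,\alpha_2$. A class of dynamics is a family $\mathcal{F}=\bigcup_{n\in\mathbb{N}_{>0}}\mathcal{F}_n$ with $\mathcal{F}_n$ a set of maps $\mathbb{R}^n\to\mathbb{R}^n$ (here: invertible linear maps). A template is a family $\mathcal{V}=\bigcup_{n\in\mathbb{N}_{>0}}\mathcal{V}_n$ with $\mathcal{V}_n$ a set of real-valued functions on $\mathbb{R}^n$. It is closed under forward composition with $\mathcal{F}$ if for all $n$, $V\in\mathcal{V}_n$ implies $V\circ f\in\mathcal{V}_n$ for all $f\in\mathcal{F}_n$. $\mathcal{G}_1\leq_{\mathcal{V},\mathcal{F}}\mathcal{G}_2$, for path-complete $\mathcal{G}_1=(S_1,E_1)$ and $\mathcal{G}_2=(S_2,E_2)$ on $\Sigma$, means: for every $n\in\mathbb{N}_{>0}$ and every family $\{f_i\,|\,i\in\Sigma\}\subseteq\mathcal{F}_n$, if there exist $V_s\in\mathcal{V}_n\cap\mathrm{Lyap}_0(\mathbb{R}^n)$,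 $s\in S_1$, with $V_a(x)\geq V_b(f_i(x))$ for all $x\in\mathbb{R}^n$ and all $(a,b,i)\in E_1$, then there exist $W_s\in\mathcal{V}_n\cap\mathrm{Lyap}_0(\mathbb{R}^n)$, $s\in S_2$, with $W_a(x)\geq W_b(f_i(x))$ for all $x\in\mathbb{R}^n$ and all $(a,b,i)\in E_2$. *)

(* Defs.v *)
From HB Require Import structures.
From mathcomp Require Import all_boot all_order all_algebra.
From mathcomp Require Import all_classical all_reals all_analysis.

Set Implicit Arguments.
Unset Strict Implicit.
Unset Printing Implicit Defensive.

Import Order.TTheory GRing.Theory Num.Theory.
Import numFieldNormedType.Exports.

Local Open Scope classical_set_scope.
Local Open Scope ring_scope.

(* Possibly infinite labeled digraphs. *)
Record ldigraph (Sigma : Type) := LDigraph {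
  lnode : Type;
  ledge : lnode -> lnode -> Sigma -> Prop }.

(* (a, b, i) is the edge from a to b labeled i. *)
Record digraph (Sigma : finType) := Digraph {
  node : finType;
  edges : {set node * node * Sigma} }.

Definition ldigraph_of_digraph (Sigma : finType) (G : digraph Sigma) :
    ldigraph Sigma :=
  LDigraph (fun (a b : node G) (i : Sigma) => (a, b, i) \in edges G).

Coercion ldigraph_of_digraph : digraph >-> ldigraph.

(* The word is w 0, ..., w (k - 1), and the nodes are s 0, ..., s k; the values
   of s beyond k are irrelevant. *)
Definition path_complete (Sigma : finType) (G : digraph Sigma) : Prop :=
  forall (k : nat) (w : 'I_k -> Sigma),
    exists s : nat -> node G, forall j : 'I_k, (s j, s j.+1, w j) \in edges G.

Definition strongly_connected (Sigma : finType) (G : digraph Sigma) : Prop :=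
  forall a b : node G,
    connect (fun c d => [exists i, (c, d, i) \in edges G]) a b.

Definition remove_edge (Sigma : finType) (G : digraph Sigma)
    (e : node G * node G * Sigma) : digraph Sigma :=
  Digraph (edges G :\ e).

Definition edge_minimal (Sigma : finType) (G : digraph Sigma) : Prop :=
  forall e, e \in edges G -> ~ path_complete (remove_edge e).

Definition simulates (Sigma : Type) (G1 G2 : ldigraph Sigma) : Prop :=
  exists r : lnode G2 -> lnode G1,
    forall a b i, ledge a b i -> ledge (r a) (r b) i.

(* For j = (j_1, ..., j_T) with T = t.+1, the belast term is
   (j_1, ..., j_(T-1)) and tnth j ord_max is j_T. *)
Definition flift (Sigma : finType) (G : digraph Sigma) (T : nat) :
    digraph Sigma :=
  match T with
  | 0 => G
  | t.+1 =>
      @Digraph Sigma (node G * t.+1.-tuple Sigma)%type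
        [set ((e.1.1, j),
              (e.1.2, [tuple of e.2 :: belast (thead j) (behead j)]),
              tnth j ord_max)
        | e in edges G, j in [set: t.+1.-tuple Sigma]]%SET
  end.

(* The node sets of the levels T = 0, 1, 2, ... are pairwise disjoint, so their
   union is a disjoint union. *)
Inductive flift_union_edge (Sigma : finType) (G : digraph Sigma) :
    {T : nat & node (flift G T)} -> {T : nat & node (flift G T)} ->
    Sigma -> Prop :=
  FliftUnionEdge (T : nat) (a b : node (flift G T)) (i : Sigma) :
    (a, b, i) \in edges (flift G T) ->
    flift_union_edge (existT _ T a) (existT _ T b) i.

Definition flift_union (Sigma : finType) (G : digraph Sigma) : ldigraph Sigma :=
  LDigraph (@flift_union_edge Sigma G).

(* The library norm on matrices is the sup norm. *)
Definition norm2 (R : realType) (n : nat) (x : 'cV[R]_n) : R :=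
  Num.sqrt (\sum_(k < n) x k 0 ^+ 2).

(* Only the restriction of alpha to [0, +oo[ matters. *)
Definition class_Kinfty (R : realType) (alpha : R -> R) : Prop :=
  [/\ {within `[0, +oo[, continuous alpha},
      alpha 0 = 0,
      forall x y : R, 0 <= x -> x < y -> alpha x < alpha y
    & alpha x @[x --> +oo] --> +oo].

Definition Lyap0 (R : realType) (n : nat) : set ('cV[R]_n -> R) :=
  [set V : 'cV[R]_n -> R |
          [/\ continuous V,
               forall x, 0 <= V x,
               V 0 = 0,
               forall x : 'cV[R]_n, x != 0 -> 0 < V x
             & exists alpha1 alpha2 : R -> R,
                 [/\ class_Kinfty alpha1, class_Kinfty alpha2
                   & forall x, alpha1 (norm2 x) <= V x <= alpha2 (norm2 x)]]].

(* Families are indexed by all n : nat, but their member at n = 0 is never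
   constrained or used: the hypotheses and the order relation assume 0 < n. *)
Definition dynamics (R : realType) := forall n : nat, set ('cV[R]_n -> 'cV[R]_n).

Definition template (R : realType) := forall n : nat, set ('cV[R]_n -> R).

Definition invertible_linear_dynamics (R : realType) (F : dynamics R) : Prop :=
  forall n f, (0 < n)%N -> F n f -> linear f /\ bijective f.

Definition closed_forward_comp (R : realType) (VV : template R)
    (F : dynamics R) : Prop :=
  forall n V f, (0 < n)%N -> VV n V -> F n f -> VV n (V \o f).

Definition certificate (R : realType) (Sigma : finType) (VV : template R)
    (G : digraph Sigma) (n : nat) (f : Sigma -> 'cV[R]_n -> 'cV[R]_n)
    (V : node G -> 'cV[R]_n -> R) : Prop :=
  (forall s, (VV n `&` @Lyap0 R n) (V s)) /\
  (forall a b i, (a, b, i) \in edges G -> forall x, V b (f i x) <= V a x).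

Definition graph_le (R : realType) (Sigma : finType) (VV : template R)
    (F : dynamics R) (G1 G2 : digraph Sigma) : Prop :=
  forall (n : nat) (f : Sigma -> 'cV[R]_n -> 'cV[R]_n),
    (0 < n)%N -> (forall i, F n (f i)) ->
    (exists V, certificate VV (G := G1) f V) ->
    exists W, certificate VV (G := G2) f W.

(* Main.v *)
Require Import Defs.
From HB Require Import structures.
From mathcomp Require Import all_boot all_order all_algebra.
From mathcomp Require Import all_classical all_reals all_analysis.

(** The graph G has a hub h and one spoke node c_k for each letter k: from h the
    letter k leads to c_k, and from c_k every letter leads back to h.  The
    other graph is its transpose: from the hub every letter leads to every spoke
    node d_k, and d_k is left only by the letter k, towards the hub.

    The ordering holds because the middle node of a two-step path of G can be
    replaced by a composition.  Given a certificate V of G, put W_h = V_h and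
    W_(d_j) = V_h o f_j.  The edge from d_j to h becomes the trivial
    V_h o f_j >= V_h o f_j, while the edge labeled i from h to d_j becomes
    V_h >= V_h o f_j o f_i, obtained by chaining the inequalities of G along
    h -i-> c_i -j-> h ([graph_le_spoke_transpose]).  So W mixes compositions of
    lengths 0 and 1, and the spoke node crossed in G depends on the letter i;
    this is what the forward composition lift cannot express, since all nodes of
    one of its levels carry words of the same length.

    Indeed, a node of a level T > 0 of the lift can only be left by the letter
    at the end of its word, whereas the hub of the transpose is left by both
    letters; by connectedness a simulation by the lift therefore lives in level
    0, that is in G ([simulates_of_flift_union]).  And G does not simulate its
    transpose, because a spoke node of G is reached by one letter only
    ([spoke_not_simulates_transpose]).

    For the ordering the class of candidate Lyapunov functions must be stable
    under composition with invertible linear maps ([Lyap0_comp]): such a map and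
    its inverse are bounded for the Euclidean norm, so the comparison functions
    only have to be rescaled.  The properties of the transpose follow from those
    of G by reading words backwards. *)

Set Implicit Arguments.
Unset Strict Implicit.
Unset Printing Implicit Defensive.

Import Order.TTheory GRing.Theory Num.Theory.
Import numFieldNormedType.Exports.

Local Open Scope classical_set_scope.
Local Open Scope ring_scope.

(** * Transposed graphs *)

Definition transpose (Sigma : finType) (G : digraph Sigma) : digraph Sigma :=
  Digraph [set e : node G * node G * Sigma |
    (e.1.2, e.1.1, e.2) \in edges G]%SET.

(** A word is read in [E'] along a path that reads its mirror image in [E].
    The inclusion form applies to graphs with a removed edge as well. *)
Lemma path_complete_reverse (Sigma V : finType) (E E' : {set V * V * Sigma}) :
  (forall a b i, (a, b, i) \in E -> (b, a, i) \in E') ->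
  path_complete (Digraph E) -> path_complete (Digraph E').
Proof.
move=> EE' pcE k w; have [s sP] := pcE k (w \o @rev_ord k).
exists (fun m => s (k - m)%N) => j.
apply: EE'; have := sP (rev_ord j).
by rewrite /= rev_ordK subnSK.
Qed.

Lemma path_complete_transpose (Sigma : finType) (G : digraph Sigma) :
  path_complete G -> path_complete (transpose G).
Proof.
by case: G => V E; apply: path_complete_reverse => a b i abi; rewrite inE.
Qed.

Lemma strongly_connected_transpose (Sigma : finType) (G : digraph Sigma) :
  strongly_connected G -> strongly_connected (transpose G).
Proof.
move=> scG a b; rewrite (eq_connect (e' := [rel c d | [exists i : Sigma,
  (d, c, i) \in edges G]])); last first.
  by move=> c d /=; apply: eq_existsb => i; rewrite inE.
by rewrite (connect_rev (fun c d => [exists i, (c, d, i) \in edges G])) /= scG.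
Qed.

Lemma edge_minimal_transpose (Sigma : finType) (G : digraph Sigma) :
  edge_minimal G -> edge_minimal (transpose G).
Proof.
case: G => V E mG [[a b] i]; rewrite inE /= => baiE.
have := mG (b, a, i) baiE; apply: contra_not.
apply: path_complete_reverse => c d j; rewrite !inE /= => /andP[cdj ->].
by rewrite andbT; apply: contraNneq cdj => -[-> -> ->].
Qed.

(** * The spoke graph *)

(** [None] is the hub and [Some k] the spoke node of the letter [k]. *)
Definition spoke_edge (Sigma : finType)
    (e : option Sigma * option Sigma * Sigma) : bool :=
  match e with
  | (None, Some k, i) => k == i
  | (Some _, None, _) => true
  | _ => false
  end.

Definition spoke_graph (Sigma : finType) : digraph Sigma :=
  Digraph [set e | @spoke_edge Sigma e]%SET.

Lemma spoke_edgeE (Sigma : finType) (a b : option Sigma) (i : Sigma) :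
  ((a, b, i) \in edges (spoke_graph Sigma)) = spoke_edge (a, b, i).
Proof. by rewrite inE. Qed.

(** Starting from the hub, the node visited at an odd time is the spoke node of
    the letter that has just been read. *)
Lemma path_complete_spoke (Sigma : finType) : path_complete (spoke_graph Sigma).
Proof.
move=> k w.
exists (fun m => if odd m then omap w (insub m.-1) else None) => j.
rewrite spoke_edgeE /=; case: (boolP (odd j)) => oj /=; last by rewrite valK /=.
have jk : (j.-1 < k)%N by apply: leq_ltn_trans (leq_pred _) (ltn_ord j).
by rewrite insubT.
Qed.

Lemma strongly_connected_spoke (Sigma : finType) :
  strongly_connected (spoke_graph Sigma).
Proof.
have fromhub (b : option Sigma) : connect
    (fun c d : node (spoke_graph Sigma) =>
       [exists i, (c, d, i) \in edges (spoke_graph Sigma)]) None b.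
  case: b => [k|]; last exact: connect0.
  by apply: connect1; apply/existsP; exists k; rewrite spoke_edgeE /=.
case=> [k|] b //; apply: connect_trans (fromhub b).
by apply: connect1; apply/existsP; exists k; rewrite spoke_edgeE.
Qed.

(** Paths alternate between the hub and the spoke nodes, so only the parity of
    the times spent at the hub is free.  If an edge on the way h -k-> c_k -i-> h
    is removed, then [k i] can no longer be read from the hub; the word
    [k i k k i] has the factor [k i] at positions 0 and 3, which rules out both
    parities. *)
Lemma edge_minimal_spoke (Sigma : finType) : edge_minimal (spoke_graph Sigma).
Proof.
have kill (k i : Sigma) (e : option Sigma * option Sigma * Sigma) :
    e = (None, Some k, k) \/ e = (Some k, None, i) ->
    ~ path_complete (@remove_edge _ (spoke_graph Sigma) e).
  move=> ke /(_ 5 (fun m => if m %% 3 == 1 then i else k)%N)[s sP].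
  have hub_dead b c : ~ ((None, b, k) \in edges (spoke_graph Sigma) :\ e /\
                         (b, c, i) \in edges (spoke_graph Sigma) :\ e)%SET.
    rewrite !in_setD1 !spoke_edgeE => -[/andP[+ kb] /andP[+ bc]].
    case: b c kb bc => [b|] // [c|] //= /eqP -> _.
    by case: ke => ->; rewrite eqxx.
  have alternates m a b :
      (a, b, m) \in (edges (spoke_graph Sigma) :\ e)%SET ->
      isSome b = ~~ isSome a.
    by rewrite in_setD1 spoke_edgeE; case: a b => [a|] [b|] //= /andP[].
  have e0 := sP (@Ordinal 5 0 isT); have e1 := sP (@Ordinal 5 1 isT).
  have e2 := sP (@Ordinal 5 2 isT); have e3 := sP (@Ordinal 5 3 isT).
  have e4 := sP (@Ordinal 5 4 isT).
  case s0E: (s 0%N) => [a|]; last first.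
    by apply: (hub_dead (s 1%N) (s 2%N)); rewrite -s0E.
  have s3E : s 3%N = None.
    move: (alternates _ _ _ e2) (alternates _ _ _ e1) (alternates _ _ _ e0).
    rewrite /= s0E /= => + + s1; rewrite s1 => + s2; rewrite s2.
    by case: (s 3%N).
  by apply: (hub_dead (s 4%N) (s 5%N)); rewrite -s3E.
case=> e i; case: e => -[a|] [b|]; rewrite spoke_edgeE //=.
  by move=> _; apply: (kill a i); right.
by move=> /eqP ->; apply: (kill i i); left.
Qed.

(** * Simulation by the forward composition lift *)

(** An option, so that membership in level 0 can be stated without transporting
    nodes along an equality between levels. *)
Definition level0 (Sigma : finType) (G : digraph Sigma)
    (u : lnode (flift_union G)) : option (node G) :=
  match u with
  | existT 0 a => Some a
  | existT _.+1 _ => None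
  end.

Lemma level0_edge (Sigma : finType) (G : digraph Sigma)
    (u v : lnode (flift_union G)) (i : Sigma) (a : node G) :
  ledge u v i -> level0 u = Some a ->
  exists2 b, level0 v = Some b & (a, b, i) \in edges G.
Proof. by case=> -[|T] c d j //= cdj [<-]; exists d. Qed.

(** In a level [T > 0] the only letter that can be read from a node is the last
    one of its word. *)
Lemma level0_branching (Sigma : finType) (G : digraph Sigma)
    (u v v' : lnode (flift_union G)) (i j : Sigma) :
  ledge u v i -> ledge u v' j -> i != j -> exists a, level0 u = Some a.
Proof.
pose reads (u : lnode (flift_union G)) := match u with
  | existT 0 a => None
  | existT _.+1 a => Some (tnth a.2 ord_max)
  end.
have readsP u1 v1 k : ledge u1 v1 k ->
    (exists a, level0 u1 = Some a) \/ reads u1 = Some k.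
  case=> -[|T] c d l /=; first by left; exists c.
  by move=> /imset2P[e w _ _ [-> _ ->]]; right.
move=> /readsP[//|ui] /readsP[//|]; rewrite ui => -[->].
by rewrite eqxx.
Qed.

(** A branching node has its image in level 0, and edges of the lift stay within
    one level, so connectedness brings the whole image into level 0. *)
Lemma simulates_of_flift_union (Sigma : finType) (G H : digraph Sigma)
    (a b b' : node H) (i j : Sigma) :
  strongly_connected H -> (a, b, i) \in edges H -> (a, b', j) \in edges H ->
  i != j -> simulates (flift_union G) H -> simulates G H.
Proof.
move=> scH abi abj ij [r rP].
have [c0 rac0] : exists c, level0 (r a) = Some c.
  exact: level0_branching (rP _ _ _ abi) (rP _ _ _ abj) ij.
have r0 d : exists c, level0 (r d) = Some c.
  have /connectP[p + ->] := scH a d.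
  elim: p a c0 rac0 {abi abj} => [|e p IH] x c xc /=; first by exists c.
  move=> /andP[/existsP[k xek] ep].
  have [c' ec' _] := level0_edge (rP _ _ _ xek) xc.
  exact: IH ec' ep.
exists (fun d => odflt c0 (level0 (r d))) => d e k dek.
have [c dc] := r0 d; have [c' ec' cc'k] := level0_edge (rP _ _ _ dek) dc.
by rewrite dc ec'.
Qed.

(** If the hub goes to the hub, the image of a spoke node is entered by [i] and
    by [j]; if the hub goes to a spoke node, that node is entered by [i] and by
    [j].  But the spoke node of [k] is entered by [k] only. *)
Lemma spoke_not_simulates_transpose (Sigma : finType) (i j : Sigma) :
  i != j -> ~ simulates (spoke_graph Sigma) (transpose (spoke_graph Sigma)).
Proof.
move=> ij [r rP].
have rE a b k : spoke_edge (b, a, k) -> spoke_edge (r a, r b, k).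
  by move=> bak; rewrite -spoke_edgeE; apply: rP; rewrite /= !inE.
have := rE None (Some i) i isT; have := rE None (Some i) j isT.
have := rE (Some i) None i (eqxx i); have := rE (Some j) None j (eqxx j).
case: (r None) => [k|]; case: (r (Some i)) => [l|] //.
  case: (r (Some j)) => //= /eqP-> /eqP ji; by rewrite ji eqxx in ij.
by move=> _ _ /= /eqP-> /eqP ji; rewrite ji eqxx in ij.
Qed.

(** * Composition of Lyapunov functions with invertible linear maps *)

Lemma linear_cV_sum (R : pzRingType) (n : nat) (f : 'cV[R]_n -> 'cV[R]_n) :
  linear f -> forall x, f x = \sum_(k < n) x k 0 *: f (delta_mx k 0).
Proof.
move=> lf x.
pose g : {linear 'cV[R]_n -> 'cV[R]_n} :=
  HB.pack f (GRing.isLinear.Build _ _ _ _ f lf).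
rewrite {1}[x]matrix_sum_delta (_ : f = g) // linear_sum.
by apply: eq_bigr => k _; rewrite big_ord1 linearZ.
Qed.

Lemma linear_inverse (R : pzRingType) (n : nat) (f g : 'cV[R]_n -> 'cV[R]_n) :
  cancel f g -> cancel g f -> linear f -> linear g.
Proof.
by move=> fK gK lf a u v; apply: (can_inj fK); rewrite lf !gK.
Qed.

Lemma linear_cV_continuous (R : realType) (n : nat)
    (f : 'cV[R]_n -> 'cV[R]_n) : linear f -> continuous f.
Proof.
move=> lf; rewrite (_ : f = fun x : 'cV[R]_n =>
    \sum_(k < n) x k 0 *: f (delta_mx k 0)); last first.
  by apply/funext => x; apply: linear_cV_sum.
apply: (continuous_big (@add_continuous 'cV[R]_n)).
move=> k _ x.
exact: (@cvgZr_tmp R 'cV[R]_n _ _ _ (fun y : 'cV[R]_n => y k 0) _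
  (f (delta_mx k 0)) (@coord_continuous R n 1 k 0 x)).
Qed.

Lemma norm2_ge0 (R : realType) (n : nat) (x : 'cV[R]_n) : 0 <= norm2 x.
Proof. exact: sqrtr_ge0. Qed.

Lemma coord_le_norm2 (R : realType) (n : nat) (x : 'cV[R]_n) (k : 'I_n) :
  `|x k 0| <= norm2 x.
Proof.
rewrite -sqrtr_sqr ler_wsqrtr // (bigD1 k) //= lerDl.
by apply: sumr_ge0 => l _; apply: sqr_ge0.
Qed.

(** Row [i] of [f] contributes at most the sum [M i] of its absolute entries;
    the summand 1 makes the constant positive when [f] is zero. *)
Lemma linear_norm2_bounded (R : realType) (n : nat)
    (f : 'cV[R]_n -> 'cV[R]_n) :
  linear f -> exists2 C, 0 < C & forall x, norm2 (f x) <= C * norm2 x.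
Proof.
move=> lf.
pose M i := \sum_(k < n) `|f (delta_mx k 0) i 0|.
have fM x i : `|f x i 0| <= M i * norm2 x.
  rewrite linear_cV_sum // summxE mulr_suml (le_trans (ler_norm_sum _ _ _)) //.
  apply: ler_sum => k _; rewrite mxE normrM mulrC.
  by rewrite ler_wpM2l // coord_le_norm2.
exists (Num.sqrt (\sum_i M i ^+ 2) + 1).
  by rewrite ltr_wpDl // sqrtr_ge0.
move=> x; apply: (@le_trans _ _ (Num.sqrt (\sum_i M i ^+ 2) * norm2 x)).
  rewrite -[norm2 x in leRHS]ger0_norm ?norm2_ge0 // -sqrtr_sqr -sqrtrM;
    last first.
    by apply: sumr_ge0 => i _; apply: sqr_ge0.
  apply: ler_wsqrtr; rewrite mulr_suml; apply: ler_sum => i _.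
  rewrite -exprMn -real_normK ?num_real // lerXn2r ?nnegrE //.
  exact: le_trans (fM x i).
by rewrite ler_wpM2r ?norm2_ge0 // lerDl.
Qed.

Lemma class_Kinfty_le (R : realType) (alpha : R -> R) (x y : R) :
  class_Kinfty alpha -> 0 <= x -> x <= y -> alpha x <= alpha y.
Proof.
move=> [_ _ inc _] x0; rewrite le_eqVlt => /predU1P[->//|xy].
by rewrite ltW // inc.
Qed.

Lemma class_Kinfty_scale (R : realType) (alpha : R -> R) (c : R) :
  0 < c -> class_Kinfty alpha -> class_Kinfty (fun x => alpha (c * x)).
Proof.
move=> c0 [cont a0 inc lim]; split.
- apply/subspace_continuousP => x; rewrite /= in_itv /= andbT => x0.
  pose P : set R := `[0, +oo[%classic.
  have cxP : P (c * x) by rewrite /P /= in_itv /= andbT mulr_ge0 // ltW.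
  have /subspace_continuousP/(_ _ cxP) := cont.
  suff cW : c * y @[y --> within P (nbhs x)] `=>` within P (nbhs (c * x)).
    exact: cvg_comp cW.
  move=> A cxA.
  have cvgc : (c * y @[y --> x]) --> c * x by apply: cvgMr; exact: cvg_id.
  have : nbhs x ((fun y => c * y) @^-1` [set y | P y -> A y]) by apply: cvgc.
  apply: filterS => y /= + y0; apply.
  by move: y0; rewrite /P /= !in_itv /= !andbT => y0; rewrite mulr_ge0 // ltW.
- by rewrite mulr0.
- by move=> x y x0 xy; apply: inc; rewrite ?mulr_ge0 ?ltr_pM2l // ltW.
- have cy : (c * x @[x --> +oo]) --> +oo.
    exact: gt0_cvgMry c0 (@cvg_id _ _).
  exact: cvg_comp cy lim.
Qed.

(** If [norm2 (f x) <= C * norm2 x] and [norm2 x <= D * norm2 (f x)], then the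
    comparison functions of [V \o f] are those of [V] rescaled by [D^-1] and
    [C]. *)
Lemma Lyap0_comp (R : realType) (n : nat) (V : 'cV[R]_n -> R)
    (f : 'cV[R]_n -> 'cV[R]_n) :
  linear f -> bijective f -> @Lyap0 R n V -> @Lyap0 R n (V \o f).
Proof.
move=> lf [g fK gK] [contV V_ge0 V0 V_gt0 [a1 [a2 [K1 K2 aV]]]].
have lg := linear_inverse fK gK lf.
have f0 : f 0 = 0.
  by rewrite linear_cV_sum // big1 // => k _; rewrite mxE scale0r.
have [C C0 fC] := linear_norm2_bounded lf.
have [D D0 gD] := linear_norm2_bounded lg.
split => /=.
- move=> x; apply: continuous_comp; first exact: linear_cV_continuous.
  exact: contV.
- by move=> x; apply: V_ge0.
- by rewrite f0.
- move=> x x0; apply: V_gt0.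
  by apply: contraNneq x0 => fx0; rewrite -(fK x) fx0 -{1}f0 fK.
- exists (fun r => a1 (D^-1 * r)), (fun r => a2 (C * r)); split.
  + by apply: class_Kinfty_scale K1; rewrite invr_gt0.
  + exact: class_Kinfty_scale K2.
  + move=> x; have /andP[a1V Va2] := aV (f x); apply/andP; split.
    * apply: le_trans a1V; apply: class_Kinfty_le => //.
        by rewrite mulr_ge0 ?norm2_ge0 // invr_ge0 ltW.
      by rewrite ler_pdivrMl // -{1}(fK x).
    * by apply: le_trans Va2 _; apply: class_Kinfty_le => //; apply: norm2_ge0.
Qed.

(** * The ordering, and the separating pair *)

(** The edge labeled [i] from the hub to [Some j] asks for the decrease of
    [V None] along [f j \o f i], which [V (Some i)] splits into two edges of the
    spoke graph; the edge from [Some j] back to the hub is an equality. *)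
Lemma graph_le_spoke_transpose (R : realType) (Sigma : finType)
    (F : dynamics R) (VV : template R) :
  invertible_linear_dynamics F -> closed_forward_comp VV F ->
  graph_le VV F (spoke_graph Sigma) (transpose (spoke_graph Sigma)).
Proof.
move=> linF closedV n f n0 Ff [V [VP VE]].
have [VVhub Lhub] := VP None.
exists (fun a => if a is Some j then V None \o f j else V None); split.
  case=> [j|]; last by split.
  split; first exact: closedV.
  by have [lf bf] := linF n (f j) n0 (Ff j); apply: Lyap0_comp.
move=> a b i; rewrite !inE /=.
case: a b => [j|] [k|] //=; first by move=> /eqP ->.
move=> _ x; apply: (@le_trans _ _ (V (Some i) (f i x))).
  by apply: VE; rewrite spoke_edgeE.
by apply: VE; rewrite spoke_edgeE /=.
Qed.

Theorem mainTheorem4 (R : realType) :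
  exists G Gt : digraph 'I_2,
    [/\ path_complete G, strongly_connected G & edge_minimal G] /\
    [/\ path_complete Gt, strongly_connected Gt & edge_minimal Gt] /\
    (forall (F : dynamics R) (VV : template R),
       invertible_linear_dynamics F -> closed_forward_comp VV F ->
       graph_le VV F G Gt) /\
    ~ simulates (flift_union G) Gt.
Proof.
have pc := @path_complete_spoke 'I_2.
have sc := @strongly_connected_spoke 'I_2.
have em := @edge_minimal_spoke 'I_2.
exists (spoke_graph 'I_2), (transpose (spoke_graph 'I_2)).
split; first by split.
split.
  split; first exact: path_complete_transpose.
  - exact: strongly_connected_transpose.
  - exact: edge_minimal_transpose.
split; first by move=> F VV; apply: graph_le_spoke_transpose.
have ne01 : ord0 != ord_max :> 'I_2 by [].
move=> /(simulates_of_flift_union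
  (H := transpose (spoke_graph 'I_2)) (a := None)
  (b := Some ord0) (b' := Some ord0) (i := ord0) (j := ord_max)) simG.
apply: (spoke_not_simulates_transpose ne01); apply: simG => //.
- exact: strongly_connected_transpose.
- by rewrite !inE.
- by rewrite !inE.
Qed.
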